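(* Let $n,b,D$ be positive integers and $0<\alpha<1$. Assume Maker plays the game $MinBox(n,D,\alpha,b)$ according to the strategy $S$: in each of his moves, Maker identifies a free active box with maximal danger value (ties broken arbitrarily) and claims one arbitrary free element from it. Then throughout the game every active box $F$ satisfies $\mathrm{dang}(F)\le b(\ln n+1)$. In particular, if $\alpha<\frac{1}{1+b}$ and $D\ge \frac{b(\ln n+1)}{1-\alpha(b+1)}$, then $S$ is a winning strategy for Maker in this game.
   Context: The game $MinBox(n,D,\alpha,b)$ is a $(1:b)$ Maker-Breaker game (Maker claims one element per turn, Breaker claims $b$ elements per turn, alternately, each claiming previously unclaimed elements) played on a family of $n$ pairwise disjoint sets (boxes), each of size at least $D$. Maker wins if he claims at least $\alpha|F|$ elements of every box $F$. During the game, $w_M(F)$ and $w_B(F)$ denote the numbers of elements of box $F$ currently claimed by Maker and Breaker, and the danger value of $F$ is $\mathrm{dang}(F)=w_B(F)-b\cdot w_M(F)$. A box is free if it contains an element not yet claimed by either player, and active if $w_M(F)<\alpha|F|$. *)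

(* Defs.v *)
From HB Require Import structures.
From mathcomp Require Import all_boot all_order all_algebra.
From mathcomp Require Import reals exp.

Set Implicit Arguments.
Unset Strict Implicit.
Unset Printing Implicit Defensive.

Import Order.TTheory GRing.Theory Num.Theory.
Local Open Scope ring_scope.

Inductive player := Maker | Breaker.

Record position (T : finType) := Position {
  claimedM : {set T};
  claimedB : {set T};
  turn : player
}.

(* A possibly nondeterministic rule for Maker: [sigma p x] means that in
   position [p] Maker is allowed to claim [x]. *)
Definition strategy (T : finType) := position T -> T -> Prop.

Section MinBox.

Variables (R : realType) (T : finType) (n D b : nat) (alpha : R).
Variable F : 'I_n -> {set T}.
Implicit Types (p : position T) (i : 'I_n) (sigma : strategy T).

Definition minbox_family : Prop :=
  (forall i, (D <= #|F i|)%N) /\ (forall i j, i != j -> [disjoint F i & F j]).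

Definition board : {set T} := \bigcup_i F i.

Definition unclaimed p : {set T} := board :\: (claimedM p :|: claimedB p).

Definition wM p i : nat := #|claimedM p :&: F i|.
Definition wB p i : nat := #|claimedB p :&: F i|.

Definition dang p i : int := (wB p i)%:Z - b%:Z * (wM p i)%:Z.

Definition free_box p i : bool := F i :&: unclaimed p != set0.

Definition active p i : bool := (wM p i)%:R < alpha * (#|F i|)%:R.

Definition maker_wins p : Prop :=
  forall i, alpha * (#|F i|)%:R <= (wM p i)%:R.

(* The positions occurring in plays in which [first] moves first, Maker follows
   [sigma] and Breaker is arbitrary. A player moves only while some element is
   unclaimed; Breaker takes exactly [b] elements, or all the remaining ones if
   fewer than [b] are left. *)
Inductive reachable sigma (first : player) : position T -> Prop :=
| reach_start : reachable sigma first (Position set0 set0 first)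
| reach_maker p (x : T) :
    reachable sigma first p -> turn p = Maker ->
    x \in unclaimed p -> sigma p x ->
    reachable sigma first (Position (x |: claimedM p) (claimedB p) Breaker)
| reach_breaker p (A : {set T}) :
    reachable sigma first p -> turn p = Breaker ->
    unclaimed p != set0 ->
    A \subset unclaimed p -> #|A| = minn b #|unclaimed p| ->
    reachable sigma first (Position (claimedM p) (A :|: claimedB p) Maker).

(* The first clause says that [sigma] never leaves Maker without a legal move.
   Every move claims an element when [b > 0], so plays are finite and end
   exactly when no element is unclaimed. *)
Definition winning_strategy (first : player) sigma : Prop :=
  (forall p, reachable sigma first p -> turn p = Maker ->
     unclaimed p != set0 -> exists2 x, x \in unclaimed p & sigma p x) /\
  (forall p, reachable sigma first p -> unclaimed p = set0 -> maker_wins p).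

Definition max_danger_box p i : Prop :=
  [/\ free_box p i, active p i
    & forall j, free_box p j -> active p j -> dang p j <= dang p i].

(* When no box is both free and active the rule imposes nothing, and Maker
   claims an arbitrary unclaimed element. *)
Definition strategyS : strategy T := fun p x =>
  (exists i, free_box p i /\ active p i) ->
  exists2 i, max_danger_box p i & x \in F i :&: unclaimed p.

End MinBox.

(* Main.v *)
Require Import Defs.
From HB Require Import structures.
From mathcomp Require Import all_boot all_order all_algebra.
From mathcomp Require Import reals exp.
From mathcomp Require Import ring lra.

(** With [H k] the [k]-th harmonic number, after every move of Maker each set
    of [k] free active boxes has average danger at most [b (H n - H k)].
    A move of Breaker adds at most [b] to the total danger of the set, so the
    average becomes at most [b (H n - H (k - 1))]. If Maker then plays inside
    the set, the total drops by [b]. Otherwise the box Maker plays in is at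
    least as dangerous as the average of the set, and the bound for the [k + 1]
    boxes together carries over to the set. For [k = 1] this bounds a single
    free active box by [b * H n <= b (ln n + 1)] at all times; a box that is no
    longer free was free before the last move that changed its danger. *)

Set Implicit Arguments.
Unset Strict Implicit.
Unset Printing Implicit Defensive.

Import Order.TTheory GRing.Theory Num.Theory.
Local Open Scope ring_scope.

(** * Harmonic numbers and the logarithm *)

Definition harmonic_number (R : realType) (k : nat) : R :=
  \sum_(j < k) (j.+1)%:R^-1.

Lemma harmonic_numberS (R : realType) k :
  harmonic_number R k.+1 = harmonic_number R k + (k.+1)%:R^-1.
Proof. by rewrite /harmonic_number big_ord_recr. Qed.

Lemma harmonic_number1 (R : realType) : harmonic_number R 1 = 1.
Proof. by rewrite /harmonic_number big_ord1 invr1. Qed.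

Lemma ler_harmonic_number (R : realType) k m :
  (k <= m)%N -> harmonic_number R k <= harmonic_number R m.
Proof.
move=> /subnK <-; elim: (m - k)%N => [|d IHd] //.
by rewrite addSn harmonic_numberS (le_trans IHd)// lerDl invr_ge0.
Qed.

(** By induction: [ln (1 + x) <= x] at [x = - 1 / (n + 2)] bounds the new term [1 / (n + 2)] by
    [ln (n + 2) - ln (n + 1)]. *)
Lemma harmonic_number_le_ln (R : realType) n :
  (0 < n)%N -> harmonic_number R n <= ln n%:R + 1.
Proof.
case: n => // n _; elim: n => [|n IHn];
  first by rewrite harmonic_number1 ln1 add0r.
have n1_gt0 : 0 < n.+1%:R :> R by rewrite ltr0n.
have n2_gt0 : 0 < n.+2%:R :> R by rewrite ltr0n.
have : ln (1 - n.+2%:R^-1) <= - n.+2%:R^-1 :> R.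
  by apply: le_ln1Dx; rewrite ltrN2 invf_lt1 ?ltr1n.
have -> : 1 - n.+2%:R^-1 = n.+1%:R / n.+2%:R :> R.
  by rewrite -[in RHS](addrK 1 n.+1%:R) natr1 mulrBl divff ?mul1r// gt_eqF.
rewrite ln_div ?posrE// harmonic_numberS lerBlDr => le_ln.
rewrite (le_trans (lerD IHn (lexx _)))// addrAC lerD2r -lerBrDr.
by rewrite addrC.
Qed.

(** Each element that Breaker claims raises the danger of at most one of the disjoint boxes, so his
    move costs at most [b] in total. *)
Lemma sum_card_disjointI (I T : finType) (F : I -> {set T}) (A : {set T}) :
  (forall i j, i != j -> [disjoint F i & F j]) ->
  (\sum_i #|A :&: F i| <= #|A|)%N.
Proof.
move=> disjF.
have disjAF i j : i != j -> [disjoint A :&: F i & A :&: F j].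
  move=> /disjF dij; apply: disjointWl (subsetIr _ _) _.
  by apply: disjointWr (subsetIr _ _) dij.
under eq_bigr do rewrite -sum1_card.
rewrite -(partition_disjoint_bigcup _ (fun=> 1%N) disjAF) sum1_card.
by apply/subset_leq_card/bigcupsP => i _; apply: subsetIl.
Qed.

Section DangerBound.

Variables (R : realType) (T : finType) (n b : nat) (alpha : R).
Variable F : 'I_n -> {set T}.
Hypothesis disjF : forall i j, i != j -> [disjoint F i & F j].
Implicit Types (p q : position T) (i : 'I_n) (S : {set 'I_n}) (A : {set T}).

Local Notation H := (harmonic_number R).
Local Notation dangR p i := ((dang b F p i)%:~R : R).
Local Notation claimM p x :=
  (Position (x |: claimedM p) (claimedB p) Breaker).
Local Notation claimB p A :=
  (Position (claimedM p) (A :|: claimedB p) Maker).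

(** * Effect of a single move on boxes and dangers *)

Lemma dangRE p i : dangR p i = (wB F p i)%:R - b%:R * (wM F p i)%:R.
Proof. by rewrite /dang rmorphB rmorphM. Qed.

Lemma free_box_claimM p x i : free_box F (claimM p x) i -> free_box F p i.
Proof.
case/set0Pn => y; rewrite !inE /= !negb_or => /and3P[yF /andP[/andP[_ yM] yB] yT].
by apply/set0Pn; exists y; rewrite !inE negb_or yF yM yB yT.
Qed.

Lemma free_box_claimB p A i : free_box F (claimB p A) i -> free_box F p i.
Proof.
case/set0Pn => y; rewrite !inE /= !negb_or => /and3P[yF /and3P[yM _ yB] yT].
by apply/set0Pn; exists y; rewrite !inE negb_or yF yM yB yT.
Qed.

Lemma wM_claimM_le p x i : (wM F p i <= wM F (claimM p x) i)%N.
Proof. by rewrite subset_leq_card// setSI// subsetUr. Qed.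

Lemma active_claimM p x i : active alpha F (claimM p x) i -> active alpha F p i.
Proof. by apply: le_lt_trans; rewrite ler_nat wM_claimM_le. Qed.

Lemma dangR_claimM_le p x i : dangR (claimM p x) i <= dangR p i.
Proof. by rewrite !dangRE lerD2l lerN2 ler_wpM2l// ler_nat wM_claimM_le. Qed.

Lemma dangR_claimM_in p x i :
  x \in F i :&: unclaimed F p -> dangR (claimM p x) i = dangR p i - b%:R.
Proof.
rewrite !inE negb_or => /and3P[xF /andP[xM _] _].
have -> : dangR (claimM p x) i = (wB F p i)%:R - b%:R * (wM F p i).+1%:R.
  rewrite dangRE /wM /=; congr (_ - _ * _%:R).
  rewrite setIUl (_ : [set x] :&: F i = [set x]); last by apply/setIidPl; rewrite sub1set.
  by rewrite cardsU1 inE (negPf xM).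
by rewrite dangRE -natr1; ring.
Qed.

Lemma dangR_claimB_le p A i : dangR (claimB p A) i <= dangR p i + #|A :&: F i|%:R.
Proof.
rewrite !dangRE addrAC lerD2r -natrD ler_nat /wB /= setIUl addnC.
exact: leq_card_setU.
Qed.

Lemma dangR_claimB_full p A i : A \subset unclaimed F p -> ~~ free_box F p i ->
  dangR (claimB p A) i = dangR p i.
Proof.
move=> /subsetP sA; rewrite negbK => /eqP full.
suff AF0 : A :&: F i = set0 by rewrite !dangRE /wB /= setIUl AF0 set0U.
apply/setP => x; rewrite inE in_set0; apply/andP => -[xA xF].
by have := in_set0 x; rewrite -full inE xF sA.
Qed.

(** * The danger invariant and its preservation *)

Definition free_active_set p S : Prop :=
  forall i, i \in S -> free_box F p i /\ active alpha F p i.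

(* The extra [b] is what the preceding move of Breaker may have added. *)
Definition danger_cap p S : R :=
  b%:R * #|S|%:R * (H n - H #|S|) + (if turn p is Maker then b%:R else 0).

(** The first clause loses sight of a box once it is full; the second keeps a bound for every active
    box, free or not. *)
Definition danger_invariant p : Prop :=
  (forall S, free_active_set p S -> \sum_(i in S) dangR p i <= danger_cap p S) /\
  (forall i, active alpha F p i -> dangR p i <= b%:R * H n).

Lemma danger_cap_ge0 p S : 0 <= danger_cap p S.
Proof.
apply: addr_ge0; last by case: (turn p).
by rewrite mulr_ge0 ?mulr_ge0// subr_ge0 ler_harmonic_number// -[leqRHS]card_ord max_card.
Qed.

Lemma danger_invariant_start first : danger_invariant (Position set0 set0 first).
Proof.
have d0 i : dangR (Position set0 set0 first) i = 0.
  by rewrite dangRE /wB /wM /= !set0I cards0 mulr0 subr0.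
split=> [S _|i _]; last by rewrite d0 mulr_ge0// sumr_ge0// => j _; rewrite invr_ge0.
by rewrite big1 ?danger_cap_ge0.
Qed.

Lemma danger_invariant_maker p x : turn p = Maker ->
  strategyS b alpha F p x -> danger_invariant p -> danger_invariant (claimM p x).
Proof.
move=> pM px [invS inv1]; split=> [S faS|i /active_claimM/inv1]; last first.
  by apply: le_trans; apply: dangR_claimM_le.
(* A member of [S] is needed to trigger the premise of [strategyS]. *)
have [->|[i0 i0S]] := set_0Vmem S; first by rewrite big_set0 danger_cap_ge0.
have faS' : free_active_set p S.
  by move=> i /faS[/free_box_claimM fi /active_claimM ai].
have [m [fm am maxm] xm] := px (ex_intro _ i0 (faS' i0 i0S)).
(* If [m] is in [S], the drop by [b] at [m] pays for the extra [b] in the cap before the move. *)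
rewrite /danger_cap /= addr0; have [mS|mS] := boolP (m \in S).
  apply: (@le_trans _ _ (\sum_(i in S) dangR p i - b%:R)); last first.
    by rewrite lerBlDr; have := invS S faS'; rewrite /danger_cap pM.
  rewrite (bigD1 m)//= [in leRHS](bigD1 m)//= dangR_claimM_in// addrAC lerD2r.
  by rewrite lerD2l ler_sum// => i _; apply: dangR_claimM_le.
apply: le_trans (ler_sum _ (fun i _ => dangR_claimM_le p x i)) _.
have famS : free_active_set p (m |: S).
  by move=> i /setU1P[->|/faS'].
have := invS _ famS.
rewrite big_setU1//= /danger_cap pM cardsU1 mS add1n harmonic_numberS.
have : \sum_(i in S) dangR p i <= #|S|%:R * dangR p m.
  rewrite mulr_natl -sumr_const ler_sum// => i /faS'[fi ai].
  by rewrite ler_int maxm.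
move: (\sum_(i in S) _) (dangR p m) => s d le_sd.
set k : R := #|S|%:R; have k_ge0 : 0 <= k by rewrite ler0n.
have k1_gt0 : 0 < k + 1 by rewrite ltr_wpDl.
rewrite -natr1 -/k => le_sum; rewrite -(ler_pM2l k1_gt0).
(* In the cap of [m |: S], the summand [1 / (k + 1)] of the harmonic number costs exactly [b], which
   cancels the extra [b] of Maker's turn. With [s <= k * d] this gives
   [(k + 1) * s <= k * (d + s)]. *)
have -> : (k + 1) * (b%:R * k * (H n - H #|S|)) =
  k * (b%:R * (k + 1) * (H n - (H #|S| + (k + 1)^-1)) + b%:R).
  by field; rewrite gt_eqF.
apply: le_trans (ler_wpM2l k_ge0 le_sum).
by rewrite mulrDl mul1r mulrDr [leRHS]addrC lerD2l.
Qed.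

Lemma danger_invariant_breaker p A : turn p = Breaker ->
  A \subset unclaimed F p -> (#|A| <= b)%N ->
  danger_invariant p -> danger_invariant (claimB p A).
Proof.
move=> pB sA leAb [invS inv1]; split=> [S faS|i ai].
  have faS' : free_active_set p S by move=> i /faS[/free_box_claimB fi ai].
  apply: le_trans (ler_sum _ (fun i _ => dangR_claimB_le p A i)) _.
  rewrite big_split /=; have := invS S faS'.
  rewrite /danger_cap pB /= addr0 => leS; apply: lerD leS _.
  rewrite -natr_sum ler_nat (leq_trans _ leAb)//.
  apply: leq_trans (sum_card_disjointI A disjF).
  by rewrite [leqRHS](bigID (mem S)) leq_addr.
(* Breaker cannot touch a full box. For a free one, the singleton cap [b * (H n - 1)] leaves room
   for the at most [b] new elements. *)
have [fi|nfi] := boolP (free_box F p i); last first.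
  by rewrite dangR_claimB_full//; apply: inv1.
have fa1 : free_active_set p [set i] by move=> j /set1P ->.
have := invS _ fa1; rewrite big_set1 /danger_cap pB cards1 harmonic_number1.
have : #|A :&: F i|%:R <= b%:R :> R.
  by rewrite ler_nat (leq_trans _ leAb)// subset_leq_card// subsetIl.
have := dangR_claimB_le p A i; lra.
Qed.

Lemma reachable_danger_invariant first p :
  reachable b F (strategyS b alpha F) first p -> danger_invariant p.
Proof.
elim=> [|{}p x _ IHp pM _ px|{}p A _ IHp pB _ sA cA].
- exact: danger_invariant_start.
- exact: danger_invariant_maker.
- by apply: danger_invariant_breaker => //; rewrite cA geq_minl.
Qed.

End DangerBound.

Lemma strategyS_has_move (R : realType) (T : finType) (n b : nat) (alpha : R)
    (F : 'I_n -> {set T}) (p : position T) :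
  unclaimed F p != set0 ->
  exists2 x, x \in unclaimed F p & strategyS b alpha F p x.
Proof.
move=> /set0Pn[y yu].
have [/existsP[i0 fa0]|/existsPn nfa] :=
  boolP [exists i, free_box F p i && active alpha F p i]; last first.
  (* The premise of [strategyS] fails, so any unclaimed element is allowed. *)
  by exists y => // -[i [fi ai]]; have := nfa i; rewrite fi ai.
pose P := [pred i | free_box F p i && active alpha F p i].
case: (@arg_maxP _ _ _ i0 P (dang b F p) fa0) => i /andP[fi ai] maxi.
have /set0Pn[x xi] := fi; exists x; first by case/setIP: xi.
by move=> _; exists i => //; split=> // j fj aj; apply: maxi; rewrite /P /= fj aj.
Qed.

Theorem theorem2p3 (R : realType) (n b D : nat) (alpha : R)
    (n_gt0 : (0 < n)%N) (b_gt0 : (0 < b)%N) (D_gt0 : (0 < D)%N)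
    (alpha_gt0 : 0 < alpha) (alpha_lt1 : alpha < 1)
    (T : finType) (F : 'I_n -> {set T}) (hF : minbox_family D F)
    (first : player) :
  (forall p : position T,
     reachable b F (strategyS b alpha F) first p ->
     forall i : 'I_n, active alpha F p i ->
       (dang b F p i)%:~R <= b%:R * (ln n%:R + 1) :> R)
  /\
  (alpha < 1 / (1 + b%:R) ->
   b%:R * (ln n%:R + 1) / (1 - alpha * (b%:R + 1)) <= D%:R ->
   winning_strategy b alpha F first (strategyS b alpha F)).
Proof.
have [leDF disjF] := hF.
have danger_le p : reachable b F (strategyS b alpha F) first p ->
    forall i : 'I_n, active alpha F p i ->
      (dang b F p i)%:~R <= b%:R * (ln n%:R + 1) :> R.
  move=> /(reachable_danger_invariant disjF)[_ inv1] i /inv1 /le_trans; apply.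
  by rewrite ler_wpM2l// harmonic_number_le_ln.
split=> // alpha_lt leD; split=> [p _ _|p rp full i].
  exact: strategyS_has_move.
rewrite leNgt; apply/negP => ai; have := danger_le p rp i ai.
have c_gt0 : 0 < 1 - alpha * (b%:R + 1).
  have b1_gt0 : 0 < 1 + b%:R :> R by rewrite ltr_wpDr.
  by move: alpha_lt; rewrite ltr_pdivlMr// subr_gt0 addrC.
move: leD; rewrite ler_pdivrMr// => leD.
(* At the end of play every element of the box is claimed. *)
have FleW : #|F i|%:R <= (wM F p i)%:R + (wB F p i)%:R :> R.
  rewrite -natrD ler_nat /wM /wB (leq_trans _ (leq_card_setU _ _))//.
  rewrite -setIUl subset_leq_card// subsetI subxx andbT.
  have FB : F i \subset board F by apply: bigcup_sup.
  by apply: subset_trans FB _; rewrite -setD_eq0; apply/eqP.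
have DleF : D%:R <= #|F i|%:R :> R by rewrite ler_nat.
(* The danger is at least [|F i| - (b + 1) * wM], and activity makes this larger than
   [|F i| * (1 - alpha * (b + 1))], hence larger than the bound. *)
rewrite leNgt dangRE => /negP; apply; apply: le_lt_trans leD _.
apply: le_lt_trans (ler_wpM2r (ltW c_gt0) DleF) _.
have ba : (b%:R + 1) * (wM F p i)%:R < (b%:R + 1) * (alpha * #|F i|%:R) :> R.
  by rewrite ltr_pM2l ?ltr_wpDl.
move: ba FleW; lra.
Qed.
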